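(* Let $p>1$ be a real number. For all $u\in H^2_0(\mathbb{N})$, the following inequality holds: $$\sum_{n=2}^\infty|u_n-u_{n-1}|^p\,n^{p-1}\ge\left(\frac{p-1}{p}\right)^p\sum_{n=2}^\infty\frac{|u_n|^p}{n\log^p(n)}.$$
   Context: $H^2_0(\mathbb{N})$ denotes the space of finitely supported real sequences $u=(u_n)_{n\ge0}$ with $u_0=u_1=0$. *)

(* Defs.v *)
From mathcomp Require Import all_boot all_order all_algebra.
From mathcomp Require Import all_classical all_reals all_analysis.

Set Implicit Arguments.
Unset Strict Implicit.
Unset Printing Implicit Defensive.

Import Order.TTheory GRing.Theory Num.Theory.
Local Open Scope classical_set_scope.
Local Open Scope ring_scope.

Definition H20 (R : realType) : set (nat -> R) :=
  [set u | [/\ finite_set [set n | u n != 0], u 0%N = 0 & u 1%N = 0]].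

(* Main.v *)
(** Elliott's telescoping proof of Hardy's inequality, with the logarithm in the
    role of the partial sums of the weights [1 / n].  Put [c = (p - 1) / p] and
    [y_n = c |u_n| / ln n].  Since [ln n - ln (n - 1) >= 1 / n], the triangle
    inequality multiplied by [y_n ^ (p - 1)], followed by Young's inequality,
    bounds [y_n ^ p / n - n ^ (p - 1) |u_n - u_(n-1)| ^ p] by [E_(n-1) - E_n],
    where [E_n = c^-1 ln n * y_n ^ p >= 0] and [E_1 = 0]. *)
Require Import Defs.
From mathcomp Require Import all_boot all_order all_algebra.
From mathcomp Require Import all_classical all_reals all_analysis.
From mathcomp Require Import ring lra.

Import Order.TTheory GRing.Theory Num.Theory.
Local Open Scope classical_set_scope.
Local Open Scope ring_scope.

(** Young's inequality for [x] and [y ^ (p - 1)] with conjugate exponents [p] and [p / (p - 1)],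
    cleared of denominators. *)
Lemma young_powRB1 (R : realType) (p x y : R) : 1 < p -> 0 <= x -> 0 <= y ->
  p * (x * y `^ (p - 1)) <= x `^ p + (p - 1) * y `^ p.
Proof.
move=> p1 x0 y0; have p0 : 0 < p by lra.
have pB1 : 0 < p - 1 by lra.
have q0 : 0 < p / (p - 1) by rewrite divr_gt0.
have pq : p^-1 + (p / (p - 1))^-1 = 1 by field; rewrite !gt_eqF.
have := conjugate_powR x0 (powR_ge0 y (p - 1)) p0 q0 pq.
rewrite -powRrM; have -> : (p - 1) * (p / (p - 1)) = p by field; rewrite gt_eqF.
rewrite -(ler_pM2l p0); congr (_ <= _).
by field; rewrite !gt_eqF.
Qed.

(** The telescoping step for abstract numbers: [M] and [L] stand for [ln (n - 1)] and [ln n], [lam]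
    for [1 / n], [x] for [n |u_n - u_(n-1)|], and [z], [y] for [y_(n-1)], [y_n]. *)
Lemma elliott_step (R : realType) (p M L lam x y z : R) : 1 < p ->
  0 <= M -> 0 <= lam -> M + lam <= L -> 0 <= x -> 0 <= y -> 0 <= z ->
  L * y <= M * z + (p - 1) / p * (lam * x) ->
  lam * y `^ p + p / (p - 1) * (L * y `^ p) <=
  lam * x `^ p + p / (p - 1) * (M * z `^ p).
Proof.
move=> p1 M0 lam0 ML x0 y0 z0 Ly.
have p0 : 0 < p by lra.
have pB1 : 0 < p - 1 by lra.
have Y0 : 0 <= y `^ p by exact: powR_ge0.
have LY : L * y `^ p <=
    M * (z * y `^ (p - 1)) + (p - 1) / p * (lam * (x * y `^ (p - 1))).
  rewrite -(mulr_powRB1 y0 p0).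
  have := ler_wpM2r (powR_ge0 y (p - 1)) Ly.
  by congr (_ <= _); ring.
have Yz := ler_wpM2l M0 (young_powRB1 _ _ _ _ p1 z0 y0).
have Yx := ler_wpM2l lam0 (young_powRB1 _ _ _ _ p1 x0 y0).
have YL := ler_wpM2r Y0 ML.
move: LY Yz Yx YL; move: (y `^ (p - 1)) => w.
move: (y `^ p) (x `^ p) (z `^ p) Y0 => Y X Z Y0 LY Yz Yx YL.
rewrite -(ler_pM2l pB1).
have -> : (p - 1) * (lam * Y + p / (p - 1) * (L * Y)) =
    (p - 1) * (lam * Y) + p * (L * Y) by field; rewrite gt_eqF.
have -> : (p - 1) * (lam * X + p / (p - 1) * (M * Z)) =
    (p - 1) * (lam * X) + p * (M * Z) by field; rewrite gt_eqF.
(* With these multipliers the products with [w] cancel. [M + lam <= L] then absorbs [M * Y], and the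
   coefficient left on [lam * Y] is [p (p - 1) - (p - 1)^2 = p - 1]. *)
have pLY := ler_wpM2l (ltW (mulr_gt0 p0 p0)) LY.
have pYz := ler_wpM2l (ltW p0) Yz.
have pYx := ler_wpM2l (ltW pB1) Yx.
have pYL := ler_wpM2l (ltW (mulr_gt0 p0 pB1)) YL.
have e : p * p * (M * (z * w) + (p - 1) / p * (lam * (x * w))) =
    p * (M * (p * (z * w))) + (p - 1) * (lam * (p * (x * w))).
  by field; rewrite gt_eqF.
rewrite e in pLY.
lra.
Qed.

(** This is [ln (1 + t) <= t] at [t = - 1 / (n + 2)]. *)
Lemma invr_le_lnB (R : realType) (n : nat) :
  n.+2%:R^-1 <= ln (n.+2%:R : R) - ln n.+1%:R.
Proof.
rewrite -[leLHS]opprK -[leRHS]opprB lerN2 -ln_div ?posrE//.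
have -> : n.+1%:R / n.+2%:R = 1 + - n.+2%:R^-1 :> R.
  by rewrite -[n.+1%:R](addrK 1) natr1 mulrBl divff// mul1r.
by apply: le_ln1Dx; rewrite ltrN2 invf_lt1// ltr1n.
Qed.

(** The boundary term [E_(N+1)] stays on the left so that the induction on [N] closes. *)
Lemma log_hardy_sum (R : realType) (p : R) (u : nat -> R) (N : nat)
    (y := fun n => (p - 1) / p * (`|u n| / ln n%:R)) :
  1 < p -> u 1%N = 0 ->
  \sum_(2 <= n < N.+2) n%:R^-1 * y n `^ p +
    p / (p - 1) * (ln N.+1%:R * y N.+1 `^ p) <=
  \sum_(2 <= n < N.+2) `|u n - u n.-1| `^ p * n%:R `^ (p - 1).
Proof.
move=> p1 u1; have p0 : 0 < p by lra.
have pB1 : 0 < p - 1 by lra.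
have y0 n : 0 <= y n.+1.
  by rewrite mulr_ge0 ?divr_ge0 ?(ltW pB1) ?(ltW p0) ?ln_ge0 ?ler1n.
elim: N => [|N IH]; first by rewrite !big_geq// ln1 mul0r mulr0 addr0.
rewrite !(@big_nat_recr _ _ _ N.+2)//=.
have L0 : 0 < ln (N.+2%:R : R) by rewrite ln_gt0// ltr1n.
have M0 : 0 <= ln (N.+1%:R : R) by rewrite ln_ge0// ler1n.
have n0 : 0 < N.+2%:R :> R by [].
set d := `|u N.+2 - u N.+1|.
have d0 : 0 <= d by exact: normr_ge0.
(* Since [n ^ (p - 1) = n^-1 * n ^ p], the weight takes the form [lam * x ^ p] of [elliott_step]. *)
have dE : d `^ p * N.+2%:R `^ (p - 1) = N.+2%:R^-1 * (N.+2%:R * d) `^ p.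
  rewrite powRM// -[in RHS](mulr_powRB1 (ltW n0) p0).
  by field; rewrite gt_eqF.
have Ly : ln N.+2%:R * y N.+2 = (p - 1) / p * `|u N.+2|.
  by rewrite /y; field; rewrite !gt_eqF.
(* For [N = 0] the logarithm vanishes and [y 1 = 0], but then [u 1 = 0]. *)
have Mz : ln N.+1%:R * y N.+1 = (p - 1) / p * `|u N.+1|.
  rewrite /y; case: (N) => [|m]; first by rewrite u1 normr0 !(mul0r, mulr0).
  have : 0 < ln (m.+2%:R : R) by rewrite ln_gt0// ltr1n.
  by move=> l0; field; rewrite !gt_eqF.
have := elliott_step R p (ln N.+1%:R) (ln N.+2%:R) N.+2%:R^-1 (N.+2%:R * d)
  (y N.+2) (y N.+1) p1 M0 _ _ _ (y0 _) (y0 _) _.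
rewrite -dE => step.
have {}step : N.+2%:R^-1 * y N.+2 `^ p + p / (p - 1) * (ln N.+2%:R * y N.+2 `^ p)
    <= d `^ p * N.+2%:R `^ (p - 1) + p / (p - 1) * (ln N.+1%:R * y N.+1 `^ p).
  apply: step; first by rewrite invr_ge0 ltW.
  - by rewrite -lerBrDl; exact: invr_le_lnB.
  - by rewrite mulr_ge0// ltW.
  rewrite Ly Mz mulKf ?gt_eqF// -mulrDr ler_pM2l ?divr_gt0//.
  by rewrite -[in leLHS](subrKC (u N.+1) (u N.+2)) ler_normD.
rewrite -addrA; apply: le_trans (lerD IH (lexx _)).
by rewrite -addrA lerD2l [leRHS]addrC.
Qed.

Theorem proposition4p8 (R : realType) (p : R) (hp : 1 < p)
    (u : nat -> R) (hu : H20 u) :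
  ((((p - 1) / p) `^ p)%:E *
     \sum_(2 <= n <oo) (`|u n| `^ p / (n%:R * (ln n%:R) `^ p))%:E
   <= \sum_(2 <= n <oo) (`|u n - u n.-1| `^ p * n%:R `^ (p - 1))%:E)%E.
Proof.
have [_ _ u1] := hu.
have p0 : 0 < p by lra.
have pB1 : 0 < p - 1 by lra.
have T0 n : (0 <= (`|u n| `^ p / (n%:R * (ln n%:R) `^ p))%:E)%E.
  by rewrite lee_fin divr_ge0 ?mulr_ge0 ?powR_ge0.
have D0 n : (0 <= (`|u n - u n.-1| `^ p * n%:R `^ (p - 1))%:E)%E.
  by rewrite lee_fin mulr_ge0 ?powR_ge0.
rewrite -nneseriesZl//; apply: lime_le.
  by apply: is_cvg_nneseries => n _ _; rewrite mule_ge0// lee_fin powR_ge0.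
(* It suffices to bound the partial sums from index 2 on, whose upper limit has the form [N.+2]. *)
exists 2%N => // -[|[|N]]// _ /=.
apply: le_trans (nneseries_lim_ge N.+2 _); last by move=> *; exact: D0.
rewrite !sumEFin lee_fin.
(* The nonnegative boundary term is dropped; the two sums on the left then agree term by term. *)
apply: le_trans (log_hardy_sum R p u N hp u1).
rewrite -[leLHS]addr0 lerD//; last first.
  by rewrite !mulr_ge0 ?invr_ge0 ?(ltW pB1) ?(ltW p0) ?powR_ge0 ?ln_ge0 ?ler1n.
rewrite le_eqVlt; apply/orP; left; apply/eqP.
apply: eq_big_nat => -[|[|n]]// _.
have l0 : 0 < ln (n.+2%:R : R) by rewrite ln_gt0// ltr1n.
rewrite !powRM ?mulr_ge0 ?invr_ge0 ?(ltW pB1) ?(ltW p0) ?(ltW l0)//.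
rewrite -[(ln _)^-1]powR_inv1 ?(ltW l0)//.
rewrite -powRrM mulN1r powRN invfM.
ring.
Qed.
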